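(* Neither $m$-equivalence $\equiv_m$ nor $1$-equivalence $\equiv_1$ on $2^\omega$ is $\Pi^0_3$ (as a subset of $2^\omega\times 2^\omega$).
   Context: For $x,y\in 2^\omega$, $x\equiv_m y$ if and only if $x\le_m y$ and $y\le_m x$, where $x\le_m y$ means there is a total computable function $\varphi_e$ with $x(n)=1\iff y(\varphi_e(n))=1$ for all $n$; $x\equiv_1 y$ is defined the same way but requiring the reducing computable functions to be one-to-one. *)

(* Defs.v *)
From Stdlib Require Import Arith Cantor FinFun.

(** Partial recursive functions, in unary form: several arguments are packed
    into one with Cantor's bijection [Cantor.to_nat : nat * nat -> nat].
    The codes may query oracles in [2^omega] indexed by [I]; taking
    [I := Empty_set] gives the ordinary partial recursive functions. *)

Notation "⟨ a , b ⟩" := (Cantor.to_nat (a, b)) (at level 0, format "⟨ a ,  b ⟩").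

Definition cantor : Type := nat -> bool.

Inductive code (I : Type) : Type :=
| Zero
| Succ
| Fst
| Snd
| Query (i : I)
| Pair (p q : code I)
| Comp (p q : code I)
| Prec (p q : code I)
| Mu (p : code I).

Arguments Zero {I}.
Arguments Succ {I}.
Arguments Fst {I}.
Arguments Snd {I}.
Arguments Query {I} i.
Arguments Pair {I} p q.
Arguments Comp {I} p q.
Arguments Prec {I} p q.
Arguments Mu {I} p.

(** The graph of the partial function [h] with [h(a, 0) = F(a)] and
    [h(a, k + 1) = G(a, k, h(a, k))]. *)
Fixpoint prec_graph (F G : nat -> nat -> Prop) (a n v : nat) : Prop :=
  match n with
  | 0 => F a v
  | S k => exists w, prec_graph F G a k w /\ G ⟨a, ⟨k, w⟩⟩ v
  end.

(** [eval o p n v]: with oracles [o], the program [p] halts on input [n] with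
    output [v]. *)
Fixpoint eval {I : Type} (o : I -> cantor) (p : code I) (n v : nat) : Prop :=
  match p with
  | Zero => v = 0
  | Succ => v = S n
  | Fst => v = fst (Cantor.of_nat n)
  | Snd => v = snd (Cantor.of_nat n)
  | Query i => v = Nat.b2n (o i n)
  | Pair p q => exists a b, eval o p n a /\ eval o q n b /\ v = ⟨a, b⟩
  | Comp p q => exists w, eval o q n w /\ eval o p w v
  | Prec p q =>
      prec_graph (eval o p) (eval o q)
        (fst (Cantor.of_nat n)) (snd (Cantor.of_nat n)) v
  | Mu p =>
      eval o p ⟨n, v⟩ 0 /\ forall j, j < v -> exists w, eval o p ⟨n, j⟩ (S w)
  end.

Definition no_oracle : Empty_set -> cantor := fun i => match i with end.

Definition computable (f : nat -> nat) : Prop :=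
  exists p : code Empty_set, forall n, eval no_oracle p n (f n).

Definition m_reducible (x y : cantor) : Prop :=
  exists f, computable f /\ forall n, x n = true <-> y (f n) = true.

Definition one_reducible (x y : cantor) : Prop :=
  exists f, computable f /\ Injective f /\
    forall n, x n = true <-> y (f n) = true.

Definition m_equiv (x y : cantor) : Prop :=
  m_reducible x y /\ m_reducible y x.

Definition one_equiv (x y : cantor) : Prop :=
  one_reducible x y /\ one_reducible y x.

(** The lightface (Kleene) arithmetical hierarchy on [2^omega * 2^omega * omega].
    The lightface classes are the meaningful ones here: being countable unions of
    closed sets, both equivalence relations are trivially boldface [Sigma^0_2]. *)

Definition oracle_pair (x y : cantor) : bool -> cantor :=
  fun i => if i then y else x.

Definition recursive_rel (R : cantor -> cantor -> nat -> Prop) : Prop :=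
  exists p : code bool, forall x y k,
    (R x y k /\ eval (oracle_pair x y) p k 1) \/
    (~ R x y k /\ eval (oracle_pair x y) p k 0).

Fixpoint Sigma0 (n : nat) (R : cantor -> cantor -> nat -> Prop) : Prop :=
  match n with
  | 0 => recursive_rel R
  | S n => exists Q, Pi0 n Q /\
      forall x y k, R x y k <-> exists m, Q x y ⟨k, m⟩
  end
with Pi0 (n : nat) (R : cantor -> cantor -> nat -> Prop) : Prop :=
  match n with
  | 0 => recursive_rel R
  | S n => exists Q, Sigma0 n Q /\
      forall x y k, R x y k <-> forall m, Q x y ⟨k, m⟩
  end.

(** A subset of [2^omega * 2^omega] is viewed as a relation with a dummy number
    argument. *)
Definition is_Pi0 (n : nat) (A : cantor -> cantor -> Prop) : Prop :=
  Pi0 n (fun x y _ => A x y).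

(* Main.v *)
From Stdlib Require Import Arith Lia List Cantor FinFun Classical ClassicalEpsilon.
Require Import Defs.

(** Let [A] be a relation lying between 1-equivalence and m-equivalence, and let
    [C] be a Sigma^0_3 set of numbers. From a real [z] and a number [e] one
    computes two sets: [left_set z], which is [z] (padded and made a cylinder),
    and [right_set (G e) z], which is [z] composed with a computable function
    [G e] whose range is cofinite iff [e] is in [C]. If the range is cofinite,
    the two sets are 1-equivalent for every [z]; otherwise a computable reduction
    of the first to the second would have to recover infinitely many bits of [z]
    from other bits, which fails for generic [z].

    If [A x y] were [forall k, exists m, forall l, R] with [R] recursive, then by
    Baire category [e] would be outside [C] iff some finite condition [sg] and
    some [k] satisfy: for all [m], every extension of [sg] can be further extended
    so as to force [~ R] for some [l]. This is a Sigma^0_3 property of [e], as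
    halting of an oracle computation over a finite condition is semidecidable.
    So all Sigma^0_3 sets would be Pi^0_3, contradicting the hierarchy theorem. *)

Import ListNotations.

Local Opaque Cantor.to_nat Cantor.of_nat.

(** * Closure properties of the computable functions *)

Definition pi1 (n : nat) : nat := fst (Cantor.of_nat n).
Definition pi2 (n : nat) : nat := snd (Cantor.of_nat n).

Lemma pi1_pair a b : pi1 ⟨a, b⟩ = a.
Proof. unfold pi1. now rewrite Cantor.cancel_of_to. Qed.

Lemma pi2_pair a b : pi2 ⟨a, b⟩ = b.
Proof. unfold pi2. now rewrite Cantor.cancel_of_to. Qed.

Lemma pair_pi n : ⟨pi1 n, pi2 n⟩ = n.
Proof.
  unfold pi1, pi2. rewrite <- surjective_pairing. apply Cantor.cancel_to_of.
Qed.

Lemma pair_inj a b c d : ⟨a, b⟩ = ⟨c, d⟩ -> a = c /\ b = d.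
Proof.
  intros E. split.
  - now rewrite <- (pi1_pair a b), E, pi1_pair.
  - now rewrite <- (pi2_pair a b), E, pi2_pair.
Qed.

Lemma pair_ge_r a b : b <= ⟨a, b⟩.
Proof. pose proof (Cantor.to_nat_non_decreasing a b). lia. Qed.

Lemma pi2_le n : pi2 n <= n.
Proof. rewrite <- (pair_pi n) at 2. apply pair_ge_r. Qed.

Local Opaque pi1 pi2.

Ltac pis := repeat rewrite ?pi1_pair, ?pi2_pair.

Definition ifz (a b c : nat) : nat := match a with 0 => b | S _ => c end.

Create HintDb comp.
#[local] Hint Constants Opaque : comp.

Lemma computable_ext f g :
  (forall n, f n = g n) -> computable f -> computable g.
Proof. intros E [p Hp]. exists p. intros n. rewrite <- E. apply Hp. Qed.

Lemma computable_id : computable (fun n => n).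
Proof.
  exists (Pair Fst Snd). intros n. exists (pi1 n), (pi2 n).
  repeat split. symmetry. apply pair_pi.
Qed.

Lemma computable_comp f g :
  computable f -> computable g -> computable (fun n => f (g n)).
Proof.
  intros [p Hp] [q Hq]. exists (Comp p q). intros n. exists (g n). auto.
Qed.

Lemma computable_succ f : computable f -> computable (fun n => S (f n)).
Proof.
  intros H. apply (computable_comp S); trivial. exists Succ. reflexivity.
Qed.

Lemma computable_const c : computable (fun _ => c).
Proof.
  induction c as [|c IH].
  - exists Zero. reflexivity.
  - now apply (computable_succ (fun _ => c)).
Qed.

Lemma computable_pi1 f : computable f -> computable (fun n => pi1 (f n)).
Proof. apply (computable_comp pi1). exists Fst. reflexivity. Qed.

Lemma computable_pi2 f : computable f -> computable (fun n => pi2 (f n)).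
Proof. apply (computable_comp pi2). exists Snd. reflexivity. Qed.

Lemma computable_pair f g :
  computable f -> computable g -> computable (fun n => ⟨f n, g n⟩).
Proof.
  intros [p Hp] [q Hq]. exists (Pair p q). intros n. exists (f n), (g n). auto.
Qed.

#[local] Hint Resolve computable_id computable_succ computable_const
  computable_pi1 computable_pi2 computable_pair : comp.

Lemma computable_rec (F : nat -> nat -> nat -> nat) b h :
  computable b ->
  computable (fun t => F (pi1 t) (pi1 (pi2 t)) (pi2 (pi2 t))) ->
  computable h ->
  computable (fun n => nat_rect (fun _ => nat) (b n) (F n) (h n)).
Proof.
  intros [pb Hb] [pF HF] Hh.
  set (H m := nat_rect (fun _ => nat) (b (pi1 m)) (F (pi1 m)) (pi2 m)).
  apply (computable_ext (fun n => H ⟨n, h n⟩));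
    [intros n; unfold H; now rewrite pi1_pair, pi2_pair|].
  apply computable_comp; [|now auto with comp].
  exists (Prec pb pF). intros m. change (prec_graph (eval no_oracle pb)
      (eval no_oracle pF) (pi1 m) (pi2 m)
      (nat_rect (fun _ => nat) (b (pi1 m)) (F (pi1 m)) (pi2 m))).
    generalize (pi1 m) as a. intros a.
    induction (pi2 m) as [|k IH]; [apply Hb|].
    eexists. split; [exact IH|].
    specialize (HF ⟨a, ⟨k, nat_rect (fun _ => nat) (b a) (F a) k⟩⟩).
    now rewrite !pi2_pair, !pi1_pair in HF.
Qed.

#[local] Hint Resolve computable_rec : comp.

Lemma computable_ifz f g h : computable f -> computable g -> computable h ->
  computable (fun n => ifz (f n) (g n) (h n)).
Proof.
  intros Hf Hg Hh. eapply computable_ext;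
    [|apply (computable_rec (fun n _ _ => h n) g f); auto with comp].
  - intros n. cbn. now destruct (f n).
  - now apply (computable_comp h); auto with comp.
Qed.

Lemma computable_pred f : computable f -> computable (fun n => pred (f n)).
Proof.
  intros Hf. eapply computable_ext;
    [|apply (computable_rec (fun _ k _ => k) (fun _ => 0) f); auto with comp].
  intros n. cbn. now destruct (f n).
Qed.

#[local] Hint Resolve computable_ifz computable_pred : comp.

Lemma computable_sub f g : computable f -> computable g ->
  computable (fun n => f n - g n).
Proof.
  intros Hf Hg. eapply computable_ext;
    [|apply (computable_rec (fun _ _ w => pred w) f g); auto with comp].
  intros n. cbn. induction (g n) as [|k IH]; cbn; lia.
Qed.

Lemma computable_add f g : computable f -> computable g ->
  computable (fun n => f n + g n).
Proof.
  intros Hf Hg. eapply computable_ext;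
    [|apply (computable_rec (fun _ _ w => S w) f g); auto with comp].
  intros n. cbn. induction (g n) as [|k IH]; cbn; lia.
Qed.

#[local] Hint Resolve computable_sub computable_add : comp.

(** Case distinctions over several tags are written as [nth] in a literal list; with this rule and
    the next, proof search settles their computability. *)
Lemma computable_nth_nil t d : computable d ->
  computable (fun n => nth (t n) [] (d n)).
Proof. apply computable_ext. intros n. now destruct (t n). Qed.

Lemma computable_nth_cons t a l d :
  computable t -> computable a ->
  computable (fun n => nth (pred (t n)) (l n) (d n)) ->
  computable (fun n => nth (t n) (a n :: l n) (d n)).
Proof.
  intros Ht Ha Hl. eapply computable_ext;
    [|exact (computable_ifz _ _ _ Ht Ha Hl)].
  intros n. cbn. now destruct (t n).
Qed.

#[local] Hint Resolve computable_nth_nil computable_nth_cons : comp.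

Definition neq (a b : nat) : nat := (a - b) + (b - a).

Lemma neq_0 a b : neq a b = 0 <-> a = b.
Proof. unfold neq. lia. Qed.

Lemma computable_neq f g : computable f -> computable g ->
  computable (fun n => neq (f n) (g n)).
Proof. unfold neq. auto with comp. Qed.

#[local] Hint Resolve computable_neq : comp.

Lemma least (P : nat -> Prop) :
  (exists n, P n) -> exists n, P n /\ forall j, j < n -> ~ P j.
Proof.
  intros [n Hn]. induction n as [n IH] using lt_wf_ind.
  destruct (classic (exists j, j < n /\ P j)) as [[j [Hj Pj]]|H].
  - exact (IH j Hj Pj).
  - exists n. split; [exact Hn|]. intros j Hj Pj. apply H. eauto.
Qed.

(** The least witness is picked classically; [Mu] computes it because the test is total and positive
    before that point. *)
Lemma computable_search (T : nat -> nat -> nat) :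
  computable (fun t => T (pi1 t) (pi2 t)) ->
  (forall n, exists v, T n v = 0) ->
  exists f, computable f /\ forall n, T n (f n) = 0.
Proof.
  intros [p Hp] H.
  assert (H' : forall n, exists v, T n v = 0 /\ forall j, j < v -> T n j <> 0)
    by (intros n; now apply least).
  set (f n := proj1_sig (constructive_indefinite_description _ (H' n))).
  assert (Hf : forall n, T n (f n) = 0 /\ forall j, j < f n -> T n j <> 0)
    by (intros n; exact (proj2_sig (constructive_indefinite_description _ (H' n)))).
  assert (Hp' : forall n v, eval no_oracle p ⟨n, v⟩ (T n v)).
  { intros n v. specialize (Hp ⟨n, v⟩). now rewrite pi1_pair, pi2_pair in Hp. }
  exists f. split; [|intros n; apply Hf].
  exists (Mu p). intros n. destruct (Hf n) as [H0 H1]. split.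
  - rewrite <- H0. apply Hp'.
  - intros j Hj. specialize (H1 j Hj). exists (pred (T n j)).
    replace (S (pred (T n j))) with (T n j) by lia. apply Hp'.
Qed.

Lemma computable_finite_change B f g :
  computable f -> (forall n, B <= n -> f n = g n) -> computable g.
Proof.
  revert f. induction B as [|B IH]; intros f Hf E.
  - apply (computable_ext f); [|exact Hf]. intros n. apply E. lia.
  - apply (IH (fun n => ifz (neq n B) (g B) (f n))); [now auto with comp|].
    intros n Hn. destruct (neq n B) as [|k] eqn:D; cbn.
    + apply (proj1 (neq_0 _ _)) in D. now subst.
    + apply E. unfold neq in D. lia.
Qed.

(** * A universal machine *)

Fixpoint encode {I : Type} (ix : I -> nat) (p : code I) : nat :=
  match p with
  | Zero => ⟨0, 0⟩
  | Succ => ⟨1, 0⟩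
  | Fst => ⟨2, 0⟩
  | Snd => ⟨3, 0⟩
  | Query i => ⟨4, ix i⟩
  | Pair p q => ⟨5, ⟨encode ix p, encode ix q⟩⟩
  | Comp p q => ⟨6, ⟨encode ix p, encode ix q⟩⟩
  | Prec p q => ⟨7, ⟨encode ix p, encode ix q⟩⟩
  | Mu p => ⟨8, encode ix p⟩
  end.

(* Machine states: [ev p n K] runs the program [p] on [n] with continuation
   stack [K]; [ret v K] passes the value [v] to the top frame of [K]. *)
Definition ev (p n K : nat) : nat := ⟨0, ⟨p, ⟨n, K⟩⟩⟩.
Definition ret (v K : nat) : nat := ⟨1, ⟨v, K⟩⟩.
Definition frame (t d K : nat) : nat := ⟨t, ⟨d, K⟩⟩.
Definition halted : nat := frame 0 0 0.

(* The oracle [orc e] returns [0] on an undefined query, on which the machine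
   loops, and [S b] when the answer is [b]. *)
Definition step_ev (orc : nat -> nat -> nat) (e p n K : nat) : nat :=
  nth (pi1 p)
    [ret 0 K; ret (S n) K; ret (pi1 n) K; ret (pi2 n) K;
     ifz (orc e ⟨pi2 p, n⟩) (ev p n K) (ret (pred (orc e ⟨pi2 p, n⟩)) K);
     ev (pi1 (pi2 p)) n (frame 1 ⟨pi2 (pi2 p), n⟩ K);
     ev (pi2 (pi2 p)) n (frame 3 (pi1 (pi2 p)) K);
     ev (pi1 (pi2 p)) (pi1 n)
       (frame 4 ⟨pi2 (pi2 p), ⟨pi1 n, ⟨0, pi2 n⟩⟩⟩ K);
     ev (pi2 p) ⟨n, 0⟩ (frame 5 ⟨pi2 p, ⟨n, 0⟩⟩ K)]
    (ev p n K).

(** Tags name the pending work: 1 and 2 the second half and the assembly of a pair, 3 a composition,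
    4 a recursion with its numbers of rounds done and left, 5 a minimisation with its current
    candidate. Tag 0 gives a fixed point, which is how halting is expressed. *)
Definition step_ret (v t d K : nat) : nat :=
  nth t
    [ret v (frame t d K);
     ev (pi1 d) (pi2 d) (frame 2 v K);
     ret ⟨d, v⟩ K;
     ev d v K;
     ifz (pi2 (pi2 (pi2 d))) (ret v K)
       (ev (pi1 d) ⟨pi1 (pi2 d), ⟨pi1 (pi2 (pi2 d)), v⟩⟩
          (frame 4 ⟨pi1 d, ⟨pi1 (pi2 d),
             ⟨S (pi1 (pi2 (pi2 d))), pred (pi2 (pi2 (pi2 d)))⟩⟩⟩ K));
     ifz v (ret (pi2 (pi2 d)) K)
       (ev (pi1 d) ⟨pi1 (pi2 d), S (pi2 (pi2 d))⟩
          (frame 5 ⟨pi1 d, ⟨pi1 (pi2 d), S (pi2 (pi2 d))⟩⟩ K))]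
    (ret v (frame t d K)).

Definition step (orc : nat -> nat -> nat) (e s : nat) : nat :=
  ifz (pi1 s)
    (step_ev orc e (pi1 (pi2 s)) (pi1 (pi2 (pi2 s))) (pi2 (pi2 (pi2 s))))
    (step_ret (pi1 (pi2 s)) (pi1 (pi2 (pi2 s)))
       (pi1 (pi2 (pi2 (pi2 s)))) (pi2 (pi2 (pi2 (pi2 s))))).

Definition run (orc : nat -> nat -> nat) (e N s : nat) : nat :=
  nat_rect (fun _ => nat) s (fun _ w => step orc e w) N.

Lemma computable_run orc :
  (forall f g, computable f -> computable g ->
    computable (fun n => orc (f n) (g n))) ->
  forall f g h, computable f -> computable g -> computable h ->
    computable (fun n => run orc (f n) (g n) (h n)).
Proof.
  intros Ho f g h Hf Hg Hh. unfold run.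
  apply (computable_rec (fun n _ w => step orc (f n) w)); trivial.
  unfold step, step_ev, step_ret, ev, ret, frame.
  assert (computable (fun t => f (pi1 t))) by (apply (computable_comp f); auto with comp).
  auto 60 with comp.
Qed.

Lemma run_add orc e N M s : run orc e (N + M) s = run orc e N (run orc e M s).
Proof. induction N as [|N IH]; cbn; [reflexivity|]. f_equal. exact IH. Qed.

Lemma run_fix orc e s N : step orc e s = s -> run orc e N s = s.
Proof. intros H. induction N as [|N IH]; cbn; [easy|]. unfold run in IH. now rewrite IH. Qed.

Lemma step_halted orc e v : step orc e (ret v halted) = ret v halted.
Proof. unfold step, ret, halted, frame. pis. reflexivity. Qed.

Lemma ret_inj v w K L : ret v K = ret w L -> v = w.
Proof. intros E. now apply pair_inj in E as [_ [E _]%pair_inj]. Qed.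

Lemma run_halted_unique orc e s N M v w :
  run orc e N s = ret v halted -> run orc e M s = ret w halted -> v = w.
Proof.
  intros HN HM. apply (ret_inj _ _ halted halted).
  destruct (Nat.le_ge_cases N M) as [H|H].
  - replace M with ((M - N) + N) in HM by lia.
    now rewrite run_add, HN, run_fix in HM by apply step_halted.
  - replace N with ((N - M) + M) in HN by lia.
    now rewrite run_add, HM, run_fix in HN by apply step_halted.
Qed.

Lemma step_mono orc e e' s :
  (forall q, orc e q = 0 \/ orc e q = orc e' q) ->
  step orc e s = s \/ step orc e s = step orc e' s.
Proof.
  intros H. unfold step. destruct (pi1 s) as [|k] eqn:E1; cbn [ifz]; [|now right].
  unfold step_ev.
  destruct (pi1 (pi1 (pi2 s))) as [|[|[|[|[|t]]]]]; try (right; reflexivity).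
  cbn [nth].
  destruct (H ⟨pi2 (pi1 (pi2 s)), pi1 (pi2 (pi2 s))⟩) as [E|E].
  - left. rewrite E. cbn [ifz]. unfold ev. now rewrite <- E1, !pair_pi.
  - right. now rewrite E.
Qed.

(** A state fixed by [step] never changes again, so in a halting run it is already the halted one;
    all steps before it are shared with [e']. *)
Lemma run_mono orc e e' :
  (forall q, orc e q = 0 \/ orc e q = orc e' q) ->
  forall N s v, run orc e N s = ret v halted ->
    exists M, run orc e' M s = ret v halted.
Proof.
  intros H. induction N as [|N IH]; intros s v E.
  - now exists 0.
  - destruct (step_mono orc e e' s H) as [F|F].
    + exists 0. rewrite run_fix in E by exact F. exact E.
    + replace (S N) with (N + 1) in E by lia. rewrite run_add in E.
      apply IH in E as [M E]. exists (M + 1). rewrite run_add.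
      cbn in *. now rewrite <- F.
Qed.

(** * Halting computations along a converging sequence of oracles *)

Definition eventually (P : nat -> Prop) : Prop :=
  exists s0, forall s, s0 <= s -> P s.

Lemma eventually_and P Q :
  eventually P -> eventually Q -> eventually (fun s => P s /\ Q s).
Proof.
  intros [a Ha] [b Hb]. exists (max a b). intros s Hs. split.
  - apply Ha. lia.
  - apply Hb. lia.
Qed.

Lemma eventually_mono (P Q : nat -> Prop) :
  (forall s, P s -> Q s) -> eventually P -> eventually Q.
Proof. intros H [a Ha]. exists a. auto. Qed.

Definition reach orc e s s' : Prop := exists N, run orc e N s = s'.

Lemma reach_trans orc e s t u :
  reach orc e s t -> reach orc e t u -> reach orc e s u.
Proof. intros [N HN] [M HM]. exists (M + N). now rewrite run_add, HN. Qed.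

Lemma reach_step orc e s t u :
  step orc e s = t -> reach orc e t u -> reach orc e s u.
Proof. intros H. apply reach_trans. now exists 1. Qed.

Lemma reach_refl orc e s : reach orc e s s.
Proof. now exists 0. Qed.

Ltac mstep := eapply reach_step;
  [unfold step, ev, ret, frame; pis; cbn [ifz];
   unfold step_ev, step_ret; pis; cbn [nth]; pis; cbn [ifz]; reflexivity
  |fold (ret) (ev) (frame)].

(* Along oracles [e 0, e 1, ...] that converge to [o], a halting computation is
   eventually reproduced: it only asks finitely many questions. *)
Lemma machine_complete {I : Type} (ix : I -> nat) (o : I -> cantor)
    (orc : nat -> nat -> nat) (e : nat -> nat) :
  (forall i n, eventually (fun s => orc (e s) ⟨ix i, n⟩ = S (Nat.b2n (o i n)))) ->
  forall p n v, eval o p n v ->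
    eventually (fun s => forall K,
      reach orc (e s) (ev (encode ix p) n K) (ret v K)).
Proof.
  intros Ho p.
  induction p as [| | | |i|p IHp q IHq|p IHp q IHq|p IHp q IHq|p IHp];
    intros n v H; cbn [eval encode] in *.
  1-4: exists 0; intros s _ K; subst v; mstep; apply reach_refl.
  - specialize (Ho i n). revert Ho. apply eventually_mono. intros s E K. subst v.
    eapply reach_step; [|apply reach_refl].
    unfold step, ev. pis. cbn [ifz]. unfold step_ev. pis. cbn [nth].
    rewrite E. reflexivity.
  - destruct H as (a & b & Ha & Hb & ->). apply IHp in Ha. apply IHq in Hb.
    generalize (eventually_and _ _ Ha Hb). apply eventually_mono.
    intros s [Pa Pb] K. mstep. eapply reach_trans; [apply Pa|]. mstep.
    eapply reach_trans; [apply Pb|]. mstep. apply reach_refl.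
  - destruct H as (w & Hq & Hp). apply IHp in Hp. apply IHq in Hq.
    generalize (eventually_and _ _ Hp Hq). apply eventually_mono.
    intros s [Pp Pq] K. mstep. eapply reach_trans; [apply Pq|]. mstep. apply Pp.
  - change (prec_graph (eval o p) (eval o q) (pi1 n) (pi2 n) v) in H.
    (* Loop invariant: [k] rounds done, [r] left. It is stated for every [r] because the frame
       counts down while the induction on [k] counts up. *)
    assert (L : forall k w, prec_graph (eval o p) (eval o q) (pi1 n) k w ->
      eventually (fun s => forall r K, reach orc (e s)
        (ev (encode ix p) (pi1 n)
          (frame 4 ⟨encode ix q, ⟨pi1 n, ⟨0, k + r⟩⟩⟩ K))
        (ret w (frame 4 ⟨encode ix q, ⟨pi1 n, ⟨k, r⟩⟩⟩ K)))).
    { induction k as [|k IHk]; intros w Hw; cbn [prec_graph] in Hw.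
      - apply IHp in Hw. revert Hw. apply eventually_mono. intros s Hw r K. apply Hw.
      - destruct Hw as (u & Hu & Hw). apply IHk in Hu. apply IHq in Hw.
        generalize (eventually_and _ _ Hu Hw). apply eventually_mono.
        intros s [Pu Pw] r K. replace (S k + r) with (k + S r) by lia.
        eapply reach_trans; [apply Pu|]. mstep. apply Pw. }
    apply L in H. revert H. apply eventually_mono. intros s H K. mstep.
    eapply reach_trans.
    + specialize (H 0 K). rewrite Nat.add_0_r in H. exact H.
    + mstep. apply reach_refl.
  - destruct H as [H0 Hlt].
    assert (L : forall j, j <= v -> eventually (fun s => forall K, reach orc (e s)
        (ev (encode ix p) ⟨n, 0⟩ (frame 5 ⟨encode ix p, ⟨n, 0⟩⟩ K))
        (ev (encode ix p) ⟨n, j⟩ (frame 5 ⟨encode ix p, ⟨n, j⟩⟩ K)))).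
    { induction j as [|j IHj]; intros Hj.
      - exists 0. intros s _ K. apply reach_refl.
      - destruct (Hlt j) as [w Hw]; [lia|]. apply IHp in Hw.
        generalize (eventually_and _ _ (IHj ltac:(lia)) Hw). apply eventually_mono.
        intros s [Pj Pw] K. eapply reach_trans; [apply Pj|].
        eapply reach_trans; [apply Pw|]. mstep. apply reach_refl. }
    apply IHp in H0. generalize (eventually_and _ _ (L v (le_n v)) H0).
    apply eventually_mono. intros s [Pv P0] K. mstep.
    eapply reach_trans; [apply Pv|]. eapply reach_trans; [apply P0|].
    mstep. apply reach_refl.
Qed.

(* Diagonalising against this [V] shows that the complement of
   [exists a, forall b, exists c, V ⟨e, ⟨a, ⟨b, c⟩⟩⟩ = 0] is not Sigma^0_3. *)
Lemma universal_Sigma3 : exists V, computable V /\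
  forall W, computable W -> exists e, forall a b,
    (exists c, V ⟨e, ⟨a, ⟨b, c⟩⟩⟩ = 0) <-> (exists c, W ⟨e, ⟨a, ⟨b, c⟩⟩⟩ = 0).
Proof.
  (* The program coded by [e] runs on a tuple containing [e], so [W] meets [V] at its own code. The
     last quantifier ranges over pairs of a witness and a number of steps. *)
  set (U e a b c :=
    neq (run (fun _ _ => 0) 0 (pi2 c) (ev e ⟨e, ⟨a, ⟨b, pi1 c⟩⟩⟩ halted))
      (ret 0 halted)).
  exists (fun n => U (pi1 n) (pi1 (pi2 n)) (pi1 (pi2 (pi2 n))) (pi2 (pi2 (pi2 n)))).
  split.
  - unfold U, ev. apply computable_neq; [|now auto with comp].
    apply computable_run; auto 20 with comp.
  - intros W [p Hp].
    set (ix := fun i : Empty_set => match i return nat with end).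
    exists (encode ix p). intros a b. pis.
    set (e := encode ix p).
    assert (R : forall c, exists N, run (fun _ _ => 0) 0 N
        (ev e ⟨e, ⟨a, ⟨b, c⟩⟩⟩ halted) = ret (W ⟨e, ⟨a, ⟨b, c⟩⟩⟩) halted).
    { intros c. destruct (machine_complete ix no_oracle (fun _ _ => 0) (fun _ => 0)
        (fun i => match i with end) p _ _ (Hp ⟨e, ⟨a, ⟨b, c⟩⟩⟩)) as [s0 H].
      exact (H s0 (le_n _) halted). }
    split; intros [c Hc].
    + unfold U in Hc. rewrite !pi2_pair, !pi1_pair in Hc. apply (proj1 (neq_0 _ _)) in Hc.
      destruct (R (pi1 c)) as [N HN]. exists (pi1 c).
      exact (run_halted_unique _ _ _ _ _ _ _ HN Hc).
    + destruct (R c) as [N HN]. exists ⟨c, N⟩. unfold U. pis.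
      apply neq_0. now rewrite HN, Hc.
Qed.

(** * Cofiniteness is Sigma^0_3-hard *)

Section Cofinite.

Variable V : nat -> nat.
Hypothesis computable_V : computable V.

Definition in_Sigma3 (e : nat) : Prop :=
  exists a, forall b, exists c, V ⟨e, ⟨a, ⟨b, c⟩⟩⟩ = 0.

(* The search looks for a [c] for [b = 0], then for one for [b = 1], and so on;
   its state after [t] tests is the next pair [⟨b, c⟩] to be tested. *)
Definition search (e a t : nat) : nat :=
  nat_rect (fun _ => nat) ⟨0, 0⟩
    (fun _ w => ifz (V ⟨e, ⟨a, w⟩⟩) ⟨S (pi1 w), 0⟩ ⟨pi1 w, S (pi2 w)⟩) t.

Definition fires (e a t : nat) : Prop := V ⟨e, ⟨a, search e a t⟩⟩ = 0.

(** The lower limit of the labels is finite exactly when some search fires infinitely often: an idle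
    position gets its own number as label, which is too large to matter. *)
Definition label (e s : nat) : nat :=
  ifz (V ⟨e, ⟨pi1 s, search e (pi1 s) (pi2 s)⟩⟩) (pi1 s) s.

(* [s >= 2] is in the range iff a later label is at most [label e s]. *)
Definition cofun (e v : nat) : nat :=
  ifz (pred (pi1 v)) (pi1 v)
    (ifz ((S (pi1 v) - pi2 v) + (label e (pi2 v) - label e (pi1 v))) (pi1 v) 0).

Lemma computable_cofun f g : computable f -> computable g ->
  computable (fun n => cofun (f n) (g n)).
Proof.
  intros Hf Hg.
  assert (HV : forall h, computable h -> computable (fun n => V (h n)))
    by (intros h; now apply computable_comp).
  assert (HS : forall h i j, computable h -> computable i -> computable j ->
    computable (fun n => search (h n) (i n) (j n))).
  { intros h i j Hh Hi Hj. unfold search.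
    assert (computable (fun t => h (pi1 t))) by (apply (computable_comp h); auto with comp).
    assert (computable (fun t => i (pi1 t))) by (apply (computable_comp i); auto with comp).
    apply (computable_rec (fun n _ w => ifz (V ⟨h n, ⟨i n, w⟩⟩)
      ⟨S (pi1 w), 0⟩ ⟨pi1 w, S (pi2 w)⟩)); auto 20 with comp. }
  assert (HL : forall h i, computable h -> computable i ->
    computable (fun n => label (h n) (i n))).
  { intros h i Hh Hi. unfold label. auto 20 with comp. }
  unfold cofun. auto 20 with comp.
Qed.

Lemma search_succ_fire e a t : fires e a t ->
  search e a (S t) = ⟨S (pi1 (search e a t)), 0⟩.
Proof.
  unfold fires. cbn. fold (search e a t). intros ->. reflexivity.
Qed.

Lemma search_succ_idle e a t : ~ fires e a t ->
  search e a (S t) = ⟨pi1 (search e a t), S (pi2 (search e a t))⟩.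
Proof.
  unfold fires. cbn. fold (search e a t).
  destruct (V ⟨e, ⟨a, search e a t⟩⟩); [easy|reflexivity].
Qed.

Lemma search_tested e a t c : c < pi2 (search e a t) ->
  V ⟨e, ⟨a, ⟨pi1 (search e a t), c⟩⟩⟩ <> 0.
Proof.
  revert c. induction t as [|t IH]; intros c.
  - cbn. pis. lia.
  - destruct (classic (fires e a t)) as [F|F].
    + rewrite search_succ_fire by exact F. pis. lia.
    + rewrite search_succ_idle by exact F. pis. intros Hc.
      destruct (Nat.eq_dec c (pi2 (search e a t))) as [->|D].
      * now rewrite pair_pi.
      * apply IH. lia.
Qed.

(** After a last firing the first component would be frozen while the second runs through all later
    [c], reaching a witness; those already passed were rejected, by [search_tested]. *)
Lemma fires_infinitely_often e a :
  (forall b, exists c, V ⟨e, ⟨a, ⟨b, c⟩⟩⟩ = 0) ->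
  forall T, exists t, T <= t /\ fires e a t.
Proof.
  intros H T. apply NNPP. intros N.
  assert (L : forall k, search e a (T + k) =
    ⟨pi1 (search e a T), pi2 (search e a T) + k⟩).
  { induction k as [|k IH].
    - now rewrite !Nat.add_0_r, pair_pi.
    - rewrite Nat.add_succ_r, search_succ_idle.
      + rewrite IH. pis. f_equal. f_equal. lia.
      + intros F. apply N. exists (T + k). split; [lia|exact F]. }
  destruct (H (pi1 (search e a T))) as [c Hc].
  destruct (Nat.lt_ge_cases c (pi2 (search e a T))) as [D|D].
  - now apply search_tested in D.
  - apply N. exists (T + (c - pi2 (search e a T))). split; [lia|].
    unfold fires. rewrite L. replace (pi2 _ + _) with c by lia. exact Hc.
Qed.

(** Each firing raises the first component of the search, which cannot pass [b]. *)
Lemma fires_finitely_often e a b :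
  (forall c, V ⟨e, ⟨a, ⟨b, c⟩⟩⟩ <> 0) ->
  exists T, forall t, fires e a t -> t < T.
Proof.
  intros H. apply NNPP. intros N.
  assert (N' : forall T, exists t, T <= t /\ fires e a t).
  { intros T. apply NNPP. intros N'. apply N. exists T. intros t Ft.
    apply Nat.nle_gt. intros Ht. apply N'. eauto. }
  assert (B : forall t, pi1 (search e a t) <= b).
  { induction t as [|t IH].
    - cbn. pis. lia.
    - destruct (classic (fires e a t)) as [F|F].
      + rewrite search_succ_fire by exact F. pis.
        enough (pi1 (search e a t) <> b) by lia. intros <-.
        apply (H (pi2 (search e a t))). rewrite pair_pi. exact F.
      + rewrite search_succ_idle by exact F. now pis. }
  assert (M : forall t k, pi1 (search e a t) <= pi1 (search e a (k + t))).
  { intros t k. induction k as [|k IH]; [easy|]. cbn [Nat.add].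
    destruct (classic (fires e a (k + t))) as [F|F].
    - rewrite search_succ_fire by exact F. pis. lia.
    - rewrite search_succ_idle by exact F. now pis. }
  assert (U : forall k, exists t, k <= pi1 (search e a t)).
  { induction k as [|k [t Ht]]; [exists 0; lia|].
    destruct (N' t) as [t' [Hle F]]. exists (S t').
    rewrite search_succ_fire by exact F. pis.
    specialize (M t (t' - t)). replace (t' - t + t) with t' in M by lia. lia. }
  destruct (U (S b)) as [t Ht]. specialize (B t). lia.
Qed.

Lemma label_bounded e : in_Sigma3 e ->
  exists a, forall T, exists s, T <= s /\ label e s <= a.
Proof.
  intros [a Ha]. exists a. intros T.
  destruct (fires_infinitely_often e a Ha T) as [t [Ht F]]. exists ⟨a, t⟩. split.
  - pose proof (pair_ge_r a t). lia.
  - unfold label. pis. rewrite F. easy.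
Qed.

(** Each of the finitely many [a' <= a] fires only finitely often, and an idle position is its own
    label. *)
Lemma label_unbounded e : ~ in_Sigma3 e ->
  forall a, exists T, forall s, label e s <= a -> s < T.
Proof.
  intros N.
  assert (H : forall a, exists T, forall t, fires e a t -> t < T).
  { intros a. apply NNPP. intros M. apply N. exists a. intros b.
    apply NNPP. intros K. apply M. apply (fires_finitely_often e a b).
    intros c Hc. apply K. eauto. }
  assert (K : forall a, exists T, forall a' t, a' <= a -> fires e a' t -> ⟨a', t⟩ < T).
  { assert (B : forall a T, exists T', forall t, t < T -> ⟨a, t⟩ < T').
    { intros a T. induction T as [|T [T' IH]].
      - exists 0. lia.
      - exists (max T' (S ⟨a, T⟩)). intros t Ht.
        destruct (Nat.eq_dec t T) as [->|D]; [lia|].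
        specialize (IH t ltac:(lia)). lia. }
    assert (B' : forall a, exists T, forall t, fires e a t -> ⟨a, t⟩ < T).
    { intros a. destruct (H a) as [T HT]. destruct (B a T) as [T' HT'].
      exists T'. auto. }
    induction a as [|a [T IH]].
    - destruct (B' 0) as [T HT]. exists T. intros a' t Ha'.
      replace a' with 0 by lia. apply HT.
    - destruct (B' (S a)) as [T' HT']. exists (max T T'). intros a' t Ha' F.
      destruct (Nat.eq_dec a' (S a)) as [->|D].
      + specialize (HT' t F). lia.
      + specialize (IH a' t ltac:(lia) F). lia. }
  intros a. destruct (K a) as [T HT]. exists (max T (S a)). intros s Hs.
  unfold label in Hs.
  destruct (V ⟨e, ⟨pi1 s, search e (pi1 s) (pi2 s)⟩⟩) eqn:E; cbn in Hs.
  - specialize (HT _ _ Hs E). rewrite pair_pi in HT. lia.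
  - lia.
Qed.

(** Let [a] be the lower limit of the labels. From [B] on no label is below [a], while labels at
    most [a] recur, so one occurring after [n] puts [n] into the range. *)
Lemma cofun_range_cofinite e : in_Sigma3 e ->
  exists B, forall n, B <= n -> exists v, cofun e v = n.
Proof.
  intros H. destruct (least _ (label_bounded e H)) as [a [Ha Hmin]].
  assert (exists B, forall s, B <= s -> a <= label e s) as [B HB].
  { apply NNPP. intros N.
    assert (N' : forall T, exists s, T <= s /\ label e s < a).
    { intros T. apply NNPP. intros M. apply N. exists T. intros s Hs.
      apply Nat.nlt_ge. intros L. apply M. eauto. }
    destruct a as [|a].
    - destruct (N' 0) as [s Hs]. lia.
    - apply (Hmin a); [lia|]. intros T. destruct (N' T) as [s Hs].
      exists s. lia. }
  exists B. intros n Hn. destruct (Ha (S n)) as [t [Ht Hl]].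
  specialize (HB n Hn). exists ⟨n, t⟩. unfold cofun. pis.
  replace (S n - t + _) with 0 by lia. now destruct (pred n).
Qed.

(** If every large [n] had a later label not exceeding its own, iterating from [n0] would give
    arbitrarily late labels bounded by [label e n0]. *)
Lemma cofun_range_coinfinite e : ~ in_Sigma3 e ->
  forall B, exists n, B <= n /\ 2 <= n /\ forall v, cofun e v <> n.
Proof.
  intros H B. apply NNPP. intros N.
  assert (C : forall n, max 2 B <= n -> exists t, n < t /\ label e t <= label e n).
  { intros n Hn. apply NNPP. intros M. apply N. exists n.
    repeat split; [lia|lia|]. intros v E. apply M. exists (pi2 v).
    unfold cofun in E.
    destruct (pred (pi1 v)) eqn:E1; cbn [ifz] in E; [lia|].
    destruct (S (pi1 v) - pi2 v + (label e (pi2 v) - label e (pi1 v))) eqn:E2;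
      cbn [ifz] in E; [|lia].
    rewrite <- E. lia. }
  set (n0 := max 2 B) in *.
  assert (I : forall T, exists t, T <= t /\ n0 <= t /\ label e t <= label e n0).
  { induction T as [|T (t & H1 & H2 & H3)].
    - exists n0. lia.
    - destruct (C t H2) as (u & H4 & H5). exists u. lia. }
  destruct (label_unbounded e H (label e n0)) as [T HT].
  destruct (I T) as (t & H1 & _ & H3). apply HT in H3. lia.
Qed.

End Cofinite.

(** * Baire category in Cantor space *)

Definition agree (s : nat) (z w : cantor) : Prop := forall n, n < s -> w n = z n.

(* [U] contains an open set that is dense in the basic open set given by the
   first [s0] bits of [z0]. *)
Definition open_dense_below (z0 : cantor) (s0 : nat) (U : cantor -> Prop) : Prop :=
  forall z s, s0 <= s -> agree s0 z0 z ->
    exists z' s', s <= s' /\ agree s z z' /\ forall w, agree s' z' w -> U w.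

Lemma open_dense_below_and z0 s0 U U' :
  open_dense_below z0 s0 U -> open_dense_below z0 s0 U' ->
  open_dense_below z0 s0 (fun w => U w /\ U' w).
Proof.
  intros H H' z s Hs Hz.
  destruct (H z s Hs Hz) as (z1 & s1 & L1 & A1 & H1).
  destruct (H' z1 s1) as (z2 & s2 & L2 & A2 & H2).
  - lia.
  - intros n Hn. rewrite A1 by lia. now apply Hz.
  - exists z2, s2. repeat split.
    + lia.
    + intros n Hn. rewrite A2 by lia. now apply A1.
    + apply H1. intros n Hn. rewrite H0 by lia. now apply A2.
    + now apply H2.
Qed.

Lemma baire z0 s0 (U : nat -> cantor -> Prop) :
  (forall j, open_dense_below z0 s0 (U j)) ->
  exists w, agree s0 z0 w /\ forall j, U j w.
Proof.
  intros H.
  set (good (c : cantor * nat) := s0 <= snd c /\ agree s0 z0 (fst c)).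
  assert (E : forall j c, exists c', good c ->
    good c' /\ snd c < snd c' /\ agree (snd c) (fst c) (fst c') /\
    forall w, agree (snd c') (fst c') w -> U j w).
  { intros j [z s]. destruct (classic (good (z, s))) as [[G1 G2]|N];
      [|exists (z, s); easy].
    cbn in G1, G2. destruct (H j z s G1 G2) as (z' & s' & L & A & HU).
    (* [S s'] makes the lengths strictly increasing, so that the chain determines every bit of the
       limit. *)
    exists (z', S s'). intros _. cbn. repeat split; cbn.
    - lia.
    - intros n Hn. rewrite A by lia. now apply G2.
    - lia.
    - exact A.
    - intros w Hw. apply HU. intros n Hn. apply Hw. lia. }
  set (next j c := proj1_sig (constructive_indefinite_description _ (E j c))).
  set (ch j := nat_rect (fun _ => (cantor * nat)%type) (z0, s0) next j).
  assert (G : forall j, good (ch j)).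
  { induction j as [|j IH]; [split; cbn; [lia|easy]|].
    exact (proj1 (proj2_sig (constructive_indefinite_description _ (E j (ch j))) IH)). }
  assert (P : forall j, snd (ch j) < snd (ch (S j)) /\
    agree (snd (ch j)) (fst (ch j)) (fst (ch (S j))) /\
    forall w, agree (snd (ch (S j))) (fst (ch (S j))) w -> U j w).
  { intros j.
    exact (proj2 (proj2_sig (constructive_indefinite_description _ (E j (ch j))) (G j))). }
  assert (L : forall j, j <= snd (ch j)).
  { induction j as [|j IH]; [lia|]. destruct (P j) as [Q _]. lia. }
  assert (M : forall j k, agree (snd (ch j)) (fst (ch j)) (fst (ch (k + j))) /\
      snd (ch j) <= snd (ch (k + j))).
  { intros j k. induction k as [|k [I1 I2]]; [easy|].
    destruct (P (k + j)) as (Q1 & Q2 & _). split; cbn [Nat.add].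
    - intros n Hn. rewrite Q2 by lia. now apply I1.
    - lia. }
  set (w n := fst (ch (S n)) n).
  assert (A : forall j, agree (snd (ch j)) (fst (ch j)) w).
  { intros j n Hn. unfold w. destruct (Nat.le_ge_cases j (S n)) as [D|D].
    - destruct (M j (S n - j)) as [Q _].
      replace (S n - j + j) with (S n) in Q by lia. now apply Q.
    - destruct (M (S n) (j - S n)) as [Q _].
      replace (j - S n + S n) with j in Q by lia.
      symmetry. apply Q. specialize (L (S n)). lia. }
  exists w. split; [exact (A 0)|]. intros j. apply (P j). apply A.
Qed.

(** * The pairs of sets attached to a computable function *)

(* Fixing two bits makes finite changes of a reduction harmless. *)
Definition pad (z : cantor) (n : nat) : bool := nth n [false; true] (z (n - 2)).

(* Both sets are cylinders, so many-one reductions between them can be made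
   injective. *)
Definition left_set (z : cantor) : cantor := fun n => pad z (pi1 n).
Definition right_set (g : nat -> nat) (z : cantor) : cantor :=
  fun n => pad z (g (pi1 n)).

Lemma one_reducible_cylinder (f : nat -> nat) (x y : cantor) :
  computable f -> (forall n, x n = y (f n)) ->
  one_reducible x (fun n => y (pi1 n)).
Proof.
  intros Hf E. exists (fun n => ⟨f n, n⟩). repeat split.
  - auto with comp.
  - intros n m H. now apply pair_inj in H.
  - rewrite pi1_pair. now rewrite E.
  - rewrite pi1_pair. now rewrite E.
Qed.

(** From right to left [g] itself reduces. From left to right one searches for a preimage under [g];
    below [B], where none may exist, finitely many values are hard-wired to [v0] or [v1] according
    to the bit. *)
Lemma one_equiv_cofinite_range g z B v0 v1 :
  computable g -> g v0 = 0 -> g v1 = 1 ->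
  (forall n, B <= n -> exists v, g v = n) ->
  one_equiv (left_set z) (right_set g z).
Proof.
  intros Hg H0 H1 H. split.
  - destruct (computable_search (fun n v => ifz (B - n) (neq (g v) n) 0))
      as [f [Hf Ef]].
    + assert (computable (fun t => g (pi2 t)))
        by (apply (computable_comp g); auto with comp).
      auto with comp.
    + intros n. destruct (Nat.le_gt_cases B n) as [D|D].
      * destruct (H n D) as [v Hv]. exists v. replace (B - n) with 0 by lia.
        now apply neq_0.
      * exists 0. destruct (B - n) eqn:E; [lia|reflexivity].
    + set (f' n := if n <? B then (if pad z n then v1 else v0) else f n).
      assert (Hf' : computable f').
      { apply (computable_finite_change B f); [exact Hf|]. intros n Hn.
        unfold f'. now rewrite (proj2 (Nat.ltb_ge n B) Hn). }
      apply (one_reducible_cylinder (fun n => f' (pi1 n)) (left_set z)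
               (fun v => pad z (g v))).
      * apply (computable_comp f'); auto with comp.
      * intros n. unfold left_set, f'. generalize (pi1 n) as k. intros k.
        destruct (Nat.ltb_spec k B) as [D|D].
        -- destruct (pad z k); [now rewrite H1|now rewrite H0].
        -- specialize (Ef k). replace (B - k) with 0 in Ef by lia.
           cbn [ifz] in Ef. apply (proj1 (neq_0 _ _)) in Ef. now rewrite Ef.
  - apply (one_reducible_cylinder (fun n => g (pi1 n)) (right_set g z) (pad z)).
    + apply (computable_comp g); auto with comp.
    + reflexivity.
Qed.

(** One requirement per code, void unless [j] codes a total program; a generic [z] can thus meet
    them all. *)
Definition eludes (g : nat -> nat) (j : nat) (z : cantor) : Prop :=
  forall (p : code Empty_set) f, encode (fun _ => 0) p = j ->
    (forall n, eval no_oracle p n (f n)) -> exists n, pad z n <> pad z (g (f n)).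

Lemma eludes_not_m_reducible g z :
  (forall j, eludes g j z) -> ~ m_reducible (left_set z) (right_set g z).
Proof.
  intros H (F & HF & E).
  assert (computable (fun n => pi1 (F ⟨n, 0⟩))) as [p Hp].
  { apply computable_pi1. apply (computable_comp F); auto with comp. }
  destruct (H _ p _ eq_refl Hp) as [n Hn]. apply Hn.
  specialize (E ⟨n, 0⟩). unfold left_set, right_set in E. rewrite pi1_pair in E.
  destruct (pad z n), (pad z (g (pi1 (F ⟨n, 0⟩)))); intuition congruence.
Qed.

(** Take [n] outside the range of [g] and beyond the condition. Then [g (f n)] differs from [n], and
    the padded bit [n], still free, can be set against the bit at [g (f n)]. *)
Lemma open_dense_eludes g z0 s0 j :
  (forall B, exists n, B <= n /\ 2 <= n /\ forall v, g v <> n) ->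
  open_dense_below z0 s0 (eludes g j).
Proof.
  intros H z s _ _.
  assert (R : forall p f, encode (fun _ : Empty_set => 0) p = j ->
    (forall n, eval no_oracle p n (f n)) -> forall n, exists N,
      run (fun _ _ => 0) 0 N (ev j n halted) = ret (f n) halted).
  { intros p f <- Hp n.
    destruct (machine_complete (fun _ => 0) no_oracle (fun _ _ => 0) (fun _ => 0)
      (fun i => match i with end) p _ _ (Hp n)) as [t Ht].
    exact (Ht t (le_n t) halted). }
  destruct (classic (exists p f, encode (fun _ : Empty_set => 0) p = j /\
    forall n, eval no_oracle p n (f n))) as [(p & f & Ej & Hp)|N].
  - destruct (H (s + 2)) as (n & Hs & H2 & Hn).
    set (i := g (f n)). assert (Hi : i <> n) by apply Hn.
    exists (fun m => if m =? n - 2 then negb (pad z i) else z m), (S (s + n + i)).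
    repeat split.
    + lia.
    + intros m Hm. destruct (Nat.eqb_spec m (n - 2)) as [->|D]; [lia|reflexivity].
    + intros w Hw p' f' Ej' Hp'. exists n.
      (* Any program with code [j] computes the same values as [p], since the machine sees only the
         code. *)
      destruct (R p f Ej Hp n) as [K HK]. destruct (R p' f' Ej' Hp' n) as [K' HK'].
      rewrite (run_halted_unique _ _ _ _ _ _ _ HK' HK). fold i.
      assert (E1 : pad w n = negb (pad z i)).
      { destruct n as [|[|n]]; [lia|lia|].
        change (pad w (S (S n))) with (nth n [] (w (S (S n) - 2))).
        rewrite Hw by lia. rewrite Nat.eqb_refl. now destruct n. }
      assert (E2 : pad w i = pad z i).
      { clearbody i. destruct i as [|[|i]]; [reflexivity|reflexivity|].
        unfold pad. cbn [nth]. rewrite Hw by lia.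
        now rewrite (proj2 (Nat.eqb_neq _ _)) by lia. }
      rewrite E1, E2. now destruct (pad z i).
  - exists z, s. repeat split; trivial. intros w _ p f Ej Hp.
    exfalso. eauto.
Qed.

(** * Finite conditions *)

(* A number codes a finite string; [lookup d n] is [0] beyond the end of the
   string and [S b] when the [n]-th bit is [b]. *)
Definition lookup (d n : nat) : nat :=
  let m := nat_rect (fun _ => nat) d (fun _ w => pi2 (pred w)) n in
  ifz m 0 (S (ifz (pi1 (pred m)) 0 1)).

Lemma computable_lookup f g : computable f -> computable g ->
  computable (fun n => lookup (f n) (g n)).
Proof.
  intros Hf Hg. unfold lookup. cbv zeta.
  assert (computable (fun n => nat_rect (fun _ => nat) (f n)
    (fun _ w => pi2 (pred w)) (g n))).
  { apply (computable_rec (fun _ _ w => pi2 (pred w))); auto with comp. }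
  auto 20 with comp.
Qed.

#[local] Hint Resolve computable_lookup : comp.

Lemma lookup_le_2 d n : lookup d n <= 2.
Proof.
  unfold lookup. cbv zeta. set (m := nat_rect _ _ _ _).
  destruct m; cbn; [lia|]. destruct (pi1 m); cbn; lia.
Qed.

(** Unpacking one entry strictly decreases a positive code, so a code bounds the length of its
    string. This crude bound serves as the length of a condition. *)
Lemma lookup_ge d n : d <= n -> lookup d n = 0.
Proof.
  intros H. unfold lookup. cbv zeta.
  assert (L : nat_rect (fun _ => nat) d (fun _ w => pi2 (pred w)) n <= d - n).
  { clear H. induction n as [|n IH]; cbn; [lia|].
    etransitivity; [apply pi2_le|]. lia. }
  destruct (nat_rect _ _ _ _); [reflexivity|lia].
Qed.

Lemma lookup_succ d n : lookup d (S n) = lookup (pi2 (pred d)) n.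
Proof.
  unfold lookup. cbv zeta.
  assert (E : nat_rect (fun _ => nat) d (fun _ w => pi2 (pred w)) (S n) =
    nat_rect (fun _ => nat) (pi2 (pred d)) (fun _ w => pi2 (pred w)) n).
  { induction n as [|n IH]; [reflexivity|]. cbn in *. now rewrite IH. }
  now rewrite E.
Qed.

Fixpoint segment (z : cantor) (s : nat) : nat :=
  match s with
  | 0 => 0
  | S s => S ⟨Nat.b2n (z 0), segment (fun n => z (S n)) s⟩
  end.

Lemma lookup_segment z s n : n < s -> lookup (segment z s) n = S (Nat.b2n (z n)).
Proof.
  revert z n. induction s as [|s IH]; intros z n Hn; [lia|].
  destruct n as [|n].
  - unfold lookup. cbn. pis. now destruct (z 0).
  - rewrite lookup_succ. cbn [segment pred]. pis. apply (IH (fun n => z (S n))). lia.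
Qed.

Lemma lookup_segment_ge z s n : s <= n -> lookup (segment z s) n = 0.
Proof.
  revert z n. induction s as [|s IH]; intros z n Hn.
  - apply lookup_ge. cbn. lia.
  - destruct n as [|n]; [lia|].
    rewrite lookup_succ. cbn [segment pred]. pis. apply (IH (fun n => z (S n))). lia.
Qed.

Definition over (f g : nat -> nat) (n : nat) : nat := ifz (f n) (g n) (f n).

Definition extends (z : cantor) (f : nat -> nat) : Prop :=
  forall n, f n = 0 \/ f n = S (Nat.b2n (z n)).

Definition total (f : nat -> nat) : cantor := fun n => f n =? 2.

Lemma over_le_2 f g : (forall n, f n <= 2) -> (forall n, g n <= 2) ->
  forall n, over f g n <= 2.
Proof.
  intros Hf Hg n. unfold over. specialize (Hf n). specialize (Hg n).
  destruct (f n); cbn; lia.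
Qed.

Lemma total_eq f n b : f n = S (Nat.b2n b) -> total f n = b.
Proof. unfold total. intros ->. now destruct b. Qed.

Lemma extends_total f s w :
  (forall n, f n <= 2) -> (forall n, s <= n -> f n = 0) ->
  agree s (total f) w -> extends w f.
Proof.
  intros H2 H0 A n. destruct (Nat.lt_ge_cases n s) as [D|D]; [|left; auto].
  rewrite A by exact D. unfold total. specialize (H2 n).
  destruct (f n) as [|[|[|k]]]; cbn; lia.
Qed.

Lemma over_assoc f g h n : over (over f g) h n = over f (over g h) n.
Proof. unfold over. now destruct (f n). Qed.

(** * The oracle computation over a finite condition *)

Section Oracle.

Variable G : nat -> nat -> nat.

(* The parameter [⟨e, ⟨sg, ⟨tu, rh⟩⟩⟩] stands for the pair of sets attached to
   [G e], at the condition [sg] overriding [tu] overriding [rh]. *)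
Definition query_index (e q : nat) : nat :=
  ifz (pi1 q) (pi1 (pi2 q)) (G e (pi1 (pi2 q))).

(** The list holds the answers for the two constant bits of [pad], shifted by one like all defined
    answers. *)
Definition oracle (c q : nat) : nat :=
  nth (query_index (pi1 c) q) [1; 2]
    (over (lookup (pi1 (pi2 c)))
       (over (lookup (pi1 (pi2 (pi2 c)))) (lookup (pi2 (pi2 (pi2 c)))))
       (query_index (pi1 c) q - 2)).

Lemma computable_oracle :
  (forall f g, computable f -> computable g -> computable (fun n => G (f n) (g n))) ->
  forall f g, computable f -> computable g -> computable (fun n => oracle (f n) (g n)).
Proof.
  intros HG f g Hf Hg.
  assert (computable (fun n => query_index (pi1 (f n)) (g n)))
    by (unfold query_index; auto 20 with comp).
  unfold oracle, over. auto 30 with comp.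
Qed.

Lemma oracle_condition e sg tu rh q :
  oracle ⟨e, ⟨sg, ⟨tu, rh⟩⟩⟩ q =
  nth (query_index e q) [1; 2]
    (over (lookup sg) (over (lookup tu) (lookup rh)) (query_index e q - 2)).
Proof. unfold oracle. now pis. Qed.

Lemma nth_pad z (f : nat -> nat) n : f (n - 2) = S (Nat.b2n (z (n - 2))) ->
  nth n [1; 2] (f (n - 2)) = S (Nat.b2n (pad z n)).
Proof. intros E. unfold pad. now destruct n as [|[|[|n]]]. Qed.

Variables (p : code bool) (e : nat) (z : cantor).

Definition oracles : bool -> cantor :=
  oracle_pair (left_set z) (right_set (G e) z).

(** Growing segments of [z] fill every gap left by [sg] and [tu], so the oracle converges to the
    true one and [machine_complete] applies. *)
Lemma eval_run_segment sg tu u v :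
  extends z (over (lookup sg) (lookup tu)) -> eval oracles p u v ->
  eventually (fun s => exists N,
    run oracle ⟨e, ⟨sg, ⟨tu, segment z s⟩⟩⟩ N (ev (encode Nat.b2n p) u halted)
    = ret v halted).
Proof.
  intros X H.
  refine (eventually_mono _ _ (fun s K => K halted)
    (machine_complete Nat.b2n oracles oracle
       (fun s => ⟨e, ⟨sg, ⟨tu, segment z s⟩⟩⟩) _ p u v H)).
  intros i n. exists (S (query_index e ⟨Nat.b2n i, n⟩)). intros s Hs.
  rewrite oracle_condition.
  replace (oracles i n) with (pad z (query_index e ⟨Nat.b2n i, n⟩)).
  2: { unfold query_index. pis. now destruct i. }
  apply nth_pad. rewrite <- over_assoc. unfold over at 1.
  destruct (X (query_index e ⟨Nat.b2n i, n⟩ - 2)) as [->| ->]; cbn [ifz].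
  - apply lookup_segment. lia.
  - reflexivity.
Qed.

(** Replacing [rh] by a long segment of [z] only adds answers, so the given run persists; the
    evaluation also yields a run there, and outputs are unique. Length [rh] suffices because a code
    bounds the length of its string. *)
Lemma run_condition_eval sg tu rh N u v :
  extends z (over (lookup sg) (over (lookup tu) (lookup rh))) ->
  run oracle ⟨e, ⟨sg, ⟨tu, rh⟩⟩⟩ N (ev (encode Nat.b2n p) u halted) = ret 0 halted ->
  eval oracles p u v -> v = 0.
Proof.
  intros X R H.
  destruct (eval_run_segment sg tu u v) as [s0 Hs0]; [|exact H|].
  { intros n. specialize (X n). rewrite <- over_assoc in X.
    unfold over in *. destruct (lookup sg n); [destruct (lookup tu n)|]; auto. }
  destruct (Hs0 (max s0 rh)) as [M HM]; [lia|].
  destruct (run_mono oracle ⟨e, ⟨sg, ⟨tu, rh⟩⟩⟩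
    ⟨e, ⟨sg, ⟨tu, segment z (max s0 rh)⟩⟩⟩) with (2 := R) as [M' HM'].
  - intros q. rewrite !oracle_condition.
    destruct (query_index e q) as [|[|i]]; [now right|now right|].
    cbn [nth]. specialize (X (S (S i) - 2)). revert X.
    generalize (S (S i) - 2) as n. intros n. unfold over.
    destruct (lookup sg n); [|now right].
    destruct (lookup tu n); [|now right]. cbn [ifz].
    intros [X|X]; [left; rewrite X; now destruct i|].
    destruct (Nat.lt_ge_cases n rh) as [D|D].
    + right. rewrite lookup_segment by lia. now rewrite X.
    + rewrite lookup_ge in X by exact D. discriminate.
  - exact (run_halted_unique _ _ _ _ _ _ _ HM HM').
Qed.

End Oracle.

(** * The category argument and the diagonal contradiction *)

Lemma not_Pi3_between (A : cantor -> cantor -> Prop) :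
  (forall x y, one_equiv x y -> A x y) -> (forall x y, A x y -> m_equiv x y) ->
  ~ is_Pi0 3 A.
Proof.
  intros A1 A2 (Q2 & (Q1 & (R & [p Hp] & E1) & E2) & E3).
  assert (HA : forall x y,
    A x y <-> forall k, exists m, forall l, R x y ⟨⟨⟨0, k⟩, m⟩, l⟩).
  { intros x y. rewrite (E3 x y 0). split; intros H k; specialize (H k).
    - apply E2 in H as [m H]. exists m. now apply E1.
    - apply E2. destruct H as [m H]. exists m. now apply E1. }
  clear E1 E2 E3 Q1 Q2.
  destruct universal_Sigma3 as [V [HV Huniv]].
  set (G := cofun V). pose proof (computable_cofun V HV) as HG. fold G in HG.
  (* The matrix of the Sigma^0_3 formula, with [⟨sg, k⟩], [⟨m, tu⟩] and [⟨⟨rh, l⟩, N⟩] as its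
     quantified numbers: over [sg], [tu] and [rh] the machine refutes [R] within [N] steps. *)
  set (W n := neq
    (run (oracle G)
      ⟨pi1 n, ⟨pi1 (pi1 (pi2 n)), ⟨pi2 (pi1 (pi2 (pi2 n))),
        pi1 (pi1 (pi2 (pi2 (pi2 n))))⟩⟩⟩
      (pi2 (pi2 (pi2 (pi2 n))))
      (ev (encode Nat.b2n p)
        ⟨⟨⟨0, pi2 (pi1 (pi2 n))⟩, pi1 (pi1 (pi2 (pi2 n)))⟩,
          pi2 (pi1 (pi2 (pi2 (pi2 n))))⟩ halted)) (ret 0 halted)).
  assert (HW : computable W).
  { unfold W, ev. apply computable_neq; [|auto with comp].
    apply computable_run; [now apply computable_oracle| | |]; auto 30 with comp. }
  (* For this [e], membership in the set given by [V] is equivalent to the formula of [W], whereas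
     by category that formula describes non-membership; both cases below are contradictory. *)
  destruct (Huniv W HW) as [e He].
  assert (EW : forall sg k m tu rh l N,
    W ⟨e, ⟨⟨sg, k⟩, ⟨⟨m, tu⟩, ⟨⟨rh, l⟩, N⟩⟩⟩⟩ = 0 <->
    run (oracle G) ⟨e, ⟨sg, ⟨tu, rh⟩⟩⟩ N
      (ev (encode Nat.b2n p) ⟨⟨⟨0, k⟩, m⟩, l⟩ halted) = ret 0 halted).
  { intros. unfold W. pis. apply neq_0. }
  clearbody W.
  destruct (classic (in_Sigma3 V e)) as [C|C].
  - assert (exists sg k, forall m tu, exists rh l N,
      W ⟨e, ⟨⟨sg, k⟩, ⟨⟨m, tu⟩, ⟨⟨rh, l⟩, N⟩⟩⟩⟩ = 0) as (sg & k & D).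
    { destruct C as [a Ha]. exists (pi1 a), (pi2 a). intros m tu.
      destruct (proj1 (He a ⟨m, tu⟩) (Ha _)) as [c Hc].
      exists (pi1 (pi1 c)), (pi2 (pi1 c)), (pi2 c). now rewrite !pair_pi. }
    (* Below [sg], the [m]-th dense open set forces a failure of [R] for [m]. The code [sg] doubles
       as a bound on the length of its string. *)
    destruct (baire (total (lookup sg)) sg (fun m z => exists l,
      ~ R (left_set z) (right_set (G e) z) ⟨⟨⟨0, k⟩, m⟩, l⟩)) as (z & _ & Hz).
    { intros m z s Hs Hz.
      destruct (D m (segment z s)) as (rh & l & N & HN). apply EW in HN.
      set (F := over (lookup sg) (over (lookup (segment z s)) (lookup rh))).
      assert (X : extends z (lookup sg)).
      { apply (extends_total _ sg); auto using lookup_le_2, lookup_ge. }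
      exists (total F), (max s rh). repeat split; [lia| |].
      - intros n Hn. apply total_eq. unfold F, over. rewrite lookup_segment by exact Hn.
        destruct (X n) as [->| ->]; reflexivity.
      - intros w Hw. exists l.
        assert (Xw : extends w F).
        { apply (extends_total F (max s rh)); [| |exact Hw].
          - repeat apply over_le_2; apply lookup_le_2.
          - intros n Hn. unfold F, over.
            rewrite (lookup_ge sg), lookup_segment_ge, lookup_ge by lia. reflexivity. }
        destruct (Hp (left_set w) (right_set (G e) w) ⟨⟨⟨0, k⟩, m⟩, l⟩)
          as [[_ H1]|[H0 _]]; [|exact H0].
        apply (run_condition_eval G p e w sg (segment z s) rh N) in H1; trivial. discriminate. }
    destruct (cofun_range_cofinite V e C) as [B HB].
    assert (HA' : A (left_set z) (right_set (G e) z)).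
    (* [cofun] sends every pair with first component 0 or 1 to that component, so both constant bits
       are in reach. *)
    { apply A1. apply (one_equiv_cofinite_range (G e) z B ⟨0, 0⟩ ⟨1, 0⟩).
      - auto with comp.
      - unfold G, cofun. now pis.
      - unfold G, cofun. now pis.
      - exact HB. }
    apply HA with (k := k) in HA' as [m Hm]. destruct (Hz m) as [l Hl]. auto.
  (* One index serves two families: [j] is the code to elude and also the outermost quantified
     number in the formula for [A]. *)
  - destruct (baire (fun _ => false) 0 (fun j z => eludes (G e) j z /\
      exists m, forall l, R (left_set z) (right_set (G e) z) ⟨⟨⟨0, j⟩, m⟩, l⟩))
      as (z & _ & Hz).
    { intros k. apply open_dense_below_and.
      - apply open_dense_eludes. exact (cofun_range_coinfinite V e C).
      - intros z s _ _.
        (* The formula fails at this condition, so some [m] and [tu] leave no run refuting [R]; a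
           failure of [R] for a real [w] extending them would show up over a long enough segment of
           [w]. *)
        assert (exists m tu, forall rh l N,
          W ⟨e, ⟨⟨segment z s, k⟩, ⟨⟨m, tu⟩, ⟨⟨rh, l⟩, N⟩⟩⟩⟩ <> 0)
          as (m & tu & D).
        { apply NNPP. intros N. apply C. exists ⟨segment z s, k⟩. intros b.
          apply He. apply NNPP. intros M. apply N. exists (pi1 b), (pi2 b).
          intros rh l K E. rewrite pair_pi in E. eauto. }
        set (F := over (lookup (segment z s)) (lookup tu)).
        exists (total F), (max s tu). repeat split; [lia| |].
        + intros n Hn. apply total_eq. unfold F, over.
          rewrite lookup_segment by exact Hn. reflexivity.
        + intros w Hw. exists m. intros l.
          assert (Xw : extends w F).
          { apply (extends_total F (max s tu)); [| |exact Hw].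
            - apply over_le_2; apply lookup_le_2.
            - intros n Hn. unfold F, over.
              rewrite lookup_segment_ge, lookup_ge by lia. reflexivity. }
          destruct (Hp (left_set w) (right_set (G e) w) ⟨⟨⟨0, k⟩, m⟩, l⟩)
            as [[H1 _]|[_ H0]]; [exact H1|exfalso].
          apply (eval_run_segment G p e w (segment z s) tu) in H0 as [t Ht];
            [|exact Xw].
          destruct (Ht t (le_n t)) as [N HN]. apply EW in HN. now apply D in HN. }
    apply (eludes_not_m_reducible (G e) z); [intros j; apply Hz|].
    refine (proj1 (A2 _ _ (proj2 (HA _ _) _))). intros k. exact (proj2 (Hz k)).
Qed.

Theorem theorem4p3 : ~ is_Pi0 3 m_equiv /\ ~ is_Pi0 3 one_equiv.
Proof.
  assert (H : forall x y, one_equiv x y -> m_equiv x y).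
  { intros x y [(f & Hf & _ & Ef) (g & Hg & _ & Eg)].
    split; [exists f|exists g]; auto. }
  split; apply not_Pi3_between; auto.
Qed.
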